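(* Let $(\mathcal X,\mathcal F,\nu)$ be a probability space equipped with an atomic filtration (as described in the context), and let $w$ be a weight with $[w]_{2,\mathcal D}<\infty$. Then for every $f\in L^2(w)$, $$\|Sf\|_{L^2(w)}\le C\,[w]_{2,\mathcal D}^{1/2}[w^{-1}]_{\infty,\mathcal D}^{1/2}\|f\|_{L^2(w)}\quad\text{and}\quad \|Sf\|_{L^2(w)}\le C\,[w]_{2,\mathcal D}\|f\|_{L^2(w)},$$ where $C$ is an absolute constant.
   Context: Atomic filtration: $\mathcal F_0\subset\mathcal F_1\subset\cdots$ is an increasing sequence of $\sigma$-algebras generating $\mathcal F$, with $\mathcal F_0=\{\emptyset,\mathcal X\}$, and each $\mathcal F_n$ is generated by a finite partition $\mathcal D_n$ of $\mathcal X$ into sets of positive measure (atoms); $\mathcal D_0=\{\mathcal X\}$. An atom is formally a pair $(I,n)$ with $I\in\mathcal D_n$; $\mathcal D=\bigcup_n\mathcal D_n$, $|I|=\nu(I)$, and $\mathrm{ch}(I)$ are the atoms of $\mathcal D_{n+1}$ contained in $I$. $\mathcal D(J)$ denotes the atoms $(I,m)$ with $I\subset J$ and $m\ge$ the generation of $J$. Averages $\langle f\rangle_I=|I|^{-1}\int_I f\,d\nu$, $\mathbb E_If=\langle f\rangle_I\mathbf 1_I$; $\Delta_I f=\sum_{I'\in\mathrm{ch}(I)}\mathbb E_{I'}f-\mathbb E_If$; $Sf=\big(\sum_{I\in\mathcal D}(\Delta_If)^2\big)^{1/2}$. A weight is an integrable $w>0$ $\nu$-a.e.; $\|f\|^2_{L^2(w)}=\int|f|^2w\,d\nu$.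 $[w]_{2,\mathcal D}=\sup_{I\in\mathcal D}\langle w\rangle_I\langle w^{-1}\rangle_I$. $M_I^{\mathcal D}f(x)=\mathbf 1_I(x)\sup_{J\in\mathcal D(I),\,x\in J}|\langle f\rangle_J|$ and, for a weight $u$, $[u]_{\infty,\mathcal D}=\sup_{I\in\mathcal D}\langle M_I^{\mathcal D}u\rangle_I/\langle u\rangle_I$. *)

(* Defs.v *)
From HB Require Import structures.
From mathcomp Require Import all_boot all_order all_algebra.
From mathcomp Require Import all_classical all_reals all_analysis.
Set Implicit Arguments. Unset Strict Implicit. Unset Printing Implicit Defensive.
Import Order.TTheory GRing.Theory Num.Theory.
Import numFieldNormedType.Exports.
Local Open Scope classical_set_scope.
Local Open Scope ring_scope.

Section Dyadic.
Context {d : measure_display} {T : measurableType d} {R : realType}.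
Variable P : probability T R.
(* D n : the finite partition D_n of T into atoms of generation n. *)
Variable D : nat -> set (set T).

Definition filt (n : nat) : set (set T) := <<s D n >>.

Definition atomic_filtration : Prop :=
  (forall n, finite_set (D n)) /\
  (forall n I, D n I -> measurable I /\ (0 < P I)%E) /\
  (forall n, trivIset (D n) (fun I => I)) /\
  (forall n, \bigcup_(I in D n) I = setT) /\
  D 0%N = [set setT] /\
  (forall n, filt n `<=` filt n.+1) /\
  <<s \bigcup_n D n >> = @measurable d T.

(* real average <f>_I (used for the functions f of L^2(w), which are
   integrable on atoms under the hypotheses) *)
Definition ravg (I : set T) (f : T -> R) : R :=
  fine (\int[P]_(x in I) (f x)%:E) / fine (P I).

(* extended-real average <g>_I (used for weights, whose averages may be +oo) *)
Definition eavg (I : set T) (g : T -> \bar R) : \bar R :=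
  ((\int[P]_(x in I) g x) * ((fine (P I))^-1)%:E)%E.

Definition ch (n : nat) (I : set T) : set (set T) :=
  [set J | D n.+1 J /\ J `<=` I].

Definition Delta (n : nat) (I : set T) (f : T -> R) (x : T) : R :=
  (\sum_(J \in ch n I) (\1_J x) * ravg J f) - (\1_I x) * ravg I f.

Definition Ssq (f : T -> R) (x : T) : \bar R :=
  (\sum_(0 <= n <oo) (\sum_(I \in D n) (Delta n I f x) ^+ 2)%:E)%E.

Definition S_L2w (w f : T -> R) : \bar R :=
  ((\int[P]_x (Ssq f x * (w x)%:E)) `^ (2^-1))%E.

Definition L2w (w f : T -> R) : \bar R :=
  ((\int[P]_x (((f x) ^+ 2 * w x)%:E)) `^ (2^-1))%E.

Definition A2 (w : T -> R) : \bar R :=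
  ereal_sup [set (eavg I (fun x => (w x)%:E) *
                  eavg I (fun x => ((w x)^-1)%:E))%E
            | I in [set I | exists n, D n I]].

Definition Mloc (m : nat) (I : set T) (u : T -> R) (x : T) : \bar R :=
  if `[< I x >] then
    ereal_sup [set `| eavg J (fun y => (u y)%:E) |%E
              | J in [set J | exists k, [/\ (m <= k)%N, D k J, J `<=` I & J x]]]
  else 0%E.

Definition Ainf (u : T -> R) : \bar R :=
  ereal_sup [set (eavg mI.2 (Mloc mI.1 mI.2 u) / eavg mI.2 (fun x => (u x)%:E))%E
            | mI in [set mI : nat * set T | D mI.1 mI.2]].

End Dyadic.

(* Main.v *)
Require Import Defs.
From HB Require Import structures.
From mathcomp Require Import all_boot all_order all_algebra.
From mathcomp Require Import all_classical all_reals all_analysis.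
From mathcomp Require Import measurable_realfun ring lra.
Import Order.TTheory GRing.Theory Num.Theory.
Import numFieldNormedType.Exports.
Local Open Scope classical_set_scope.
Local Open Scope ring_scope.

(** Write [u = 1/w], [Q = [w]_2], and let [u_n], [w_n], [f_n] be the averages
    over the atoms of generation [n], so that [1 <= u_n w_n <= Q]. Put
    [c = f_n / u_n] and split
    [f_(n+1) - f_n = (f_(n+1) - c u_(n+1)) + c (u_(n+1) - u_n)].
    As [w_(n+1) <= Q / u_(n+1)], the squares of the first terms telescope by
    the convexity of [x ^+ 2 / y], at the cost [2 Q]. For the second terms it
    suffices that the masses [(u_(n+1) - u_n) ^+ 2 w_(n+1)] form a Carleson
    sequence with respect to [u]; the embedding is then the Bellman function
    [x ^+ 2 / (y + A)], where [A] is the normalized packing mass below the atom.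

    Packing: pointwise [(u_(n+1) - u_n) ^+ 2 w_(n+1)] is at most
    [16 Q (sqrt u_(n+1) - sqrt u_n) ^+ 2
     + 4 u_n ^+ 2 (sqrt w_(n+1) - sqrt w_n) ^+ 2].
    Atoms may be much smaller than their parents, so logarithms of [u] are of
    no use. Instead, with [m] the running maximum of [u], both parts are
    controlled through the supermartingale differences of [sqrt u] and [sqrt w]
    multiplied by [sqrt m], resp. [m `^ (3/2)]: after a summation by parts
    only the times at which [m] jumps matter, where [m = u], and everything is
    at most a multiple of [Q] times the mean of the final [m], that is of the
    local maximal function. The same device gives the mean of [m] the bound
    [2 Q] times that of [u], whence the second estimate. *)

(** * Weighted trees *)

Section TreeCarleson.
Context {R : rcfType} {X : eqType} (c : X -> seq X) (V : X -> Prop).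
(** In the application these are the masses of the probability, of [u = 1/w] and of [w] on the nodes
    of the tree of atoms, and [V] marks the genuine atoms. *)
Context (p s v : X -> R) (Q : R).
Hypothesis Vc : forall I J, V I -> J \in c I -> V J.
Hypothesis p_gt0 : forall I, V I -> 0 < p I.
Hypothesis s_gt0 : forall I, V I -> 0 < s I.
Hypothesis v_gt0 : forall I, V I -> 0 < v I.
Hypothesis pD : forall I, V I -> p I = \sum_(J <- c I) p J.
Hypothesis sD : forall I, V I -> s I = \sum_(J <- c I) s J.
Hypothesis vD : forall I, V I -> v I = \sum_(J <- c I) v J.
Hypothesis p_le_vs : forall I, V I -> p I ^+ 2 <= v I * s I.
Hypothesis vs_le_p : forall I, V I -> v I * s I <= Q * p I ^+ 2.

Definition avg (g : X -> R) I := g I / p I.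

(* The mass-weighted mean of the maximum of [m] and of the averages of [s]
   along the descending paths of length [k] from [I]. *)
Fixpoint pathmax (k : nat) (m : R) (I : X) : R :=
  let m' := Num.max m (avg s I) in
  if k is k'.+1 then \sum_(J <- c I) pathmax k' m' J else m' * p I.

(** Each edge counts once and unweighted, so the edge term [e] has to carry the mass of the
    child. *)
Fixpoint path_sum (e : X -> X -> R) (k : nat) (I : X) : R :=
  if k is k'.+1 then \sum_(J <- c I) (e I J + path_sum e k' J) else 0.

Lemma avgK g I : V I -> avg g I * p I = g I.
Proof. by move=> VI; rewrite /avg divfK // gt_eqF ?p_gt0. Qed.

Lemma avg_gt0 g I : V I -> (forall J, V J -> 0 < g J) -> 0 < avg g I.
Proof. by move=> VI g0; rewrite /avg divr_gt0 ?g0 ?p_gt0. Qed.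

Lemma avg_vs_le I : V I -> avg v I * avg s I <= Q.
Proof.
move=> VI; have := vs_le_p _ VI; rewrite -(avgK v _ VI) -(avgK s _ VI).
by have p0 := p_gt0 _ VI; rewrite mulrACA -expr2 ler_pM2r // exprn_gt0.
Qed.

Lemma avg_vs_ge I : V I -> 1 <= avg v I * avg s I.
Proof.
move=> VI; have := p_le_vs _ VI; rewrite -(avgK v _ VI) -(avgK s _ VI).
by have p0 := p_gt0 _ VI; rewrite mulrACA -expr2 ler_pMl // exprn_gt0.
Qed.

Lemma Q_ge1 I : V I -> 1 <= Q.
Proof. by move=> VI; apply: le_trans (avg_vs_ge _ VI) (avg_vs_le _ VI). Qed.

Lemma ler_sum_child (f g : X -> R) I : V I ->
  (forall J, J \in c I -> V J -> f J <= g J) ->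
  \sum_(J <- c I) f J <= \sum_(J <- c I) g J.
Proof.
move=> VI fg; rewrite big_seq [leRHS]big_seq; apply: ler_sum => J JI.
by apply: fg => //; apply: Vc JI.
Qed.

Lemma path_sum_le e1 e2 k I : V I ->
  (forall I J, V I -> V J -> J \in c I -> e1 I J <= e2 I J) ->
  path_sum e1 k I <= path_sum e2 k I.
Proof.
move=> + e12; elim: k I => //= k IH I VI.
by apply: ler_sum_child => // J JI VJ; rewrite lerD ?IH ?e12.
Qed.

Lemma path_sum_lin e1 e2 a b k I :
  path_sum (fun I J => a * e1 I J + b * e2 I J) k I =
  a * path_sum e1 k I + b * path_sum e2 k I.
Proof.
elim: k I => [|k IH] I /=; first by rewrite !mulr0 addr0.
rewrite !mulr_sumr -big_split; apply: eq_bigr => J _ /=; rewrite IH; ring.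
Qed.

Lemma pathmax_max k m I : pathmax k (Num.max m (avg s I)) I = pathmax k m I.
Proof. by case: k => [|k] /=; rewrite -maxA maxxx. Qed.

Lemma pathmax0 k I : V I -> pathmax k 0 I = pathmax k (avg s I) I.
Proof.
by move=> VI; rewrite -pathmax_max max_r // ltW // avg_gt0.
Qed.

Lemma pathmaxS k m I : V I -> avg s I <= m ->
  pathmax k.+1 m I = \sum_(J <- c I) pathmax k (Num.max m (avg s J)) J.
Proof.
move=> VI sm /=; rewrite max_l //; apply: eq_bigr => J _.
by rewrite pathmax_max.
Qed.

(* [B] is a Bellman function of the running maximum and the current node. *)
Lemma path_sum_pathmax (e : X -> X -> R) (B : R -> X -> R) (a : R) :
  (forall m I, V I -> avg s I <= m -> 0 <= B m I + a * m * p I) ->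
  (forall m I, V I -> avg s I <= m ->
    \sum_(J <- c I) (e I J + B (Num.max m (avg s J)) J) <= B m I) ->
  forall k m I, V I -> avg s I <= m ->
  path_sum e k I <= B m I + a * pathmax k m I.
Proof.
move=> B0 BS; elim=> [|k IH] m I VI sm.
  by rewrite /= max_l // mulrA B0.
rewrite pathmaxS //=; apply: le_trans (lerD (BS _ _ VI sm) (lexx _)).
rewrite mulr_sumr -big_split /=.
apply: ler_sum_child => // J JI VJ.
by rewrite -addrA lerD2l IH // le_max lexx orbT.
Qed.

(* The term in [l] is a martingale difference, hence averages out. *)
Lemma Bellman_step (e : X -> R) (b : X -> R) (g : X -> R) (b0 l : R) I : V I ->
  (forall I, V I -> g I = \sum_(J <- c I) g J) ->
  (forall J, V J -> J \in c I -> e J + b J <= b0 + l * (avg g J - avg g I)) ->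
  \sum_(J <- c I) (e J * p J + b J * p J) <= b0 * p I.
Proof.
move=> VI gD eb.
have -> : b0 * p I = \sum_(J <- c I) (b0 + l * (avg g J - avg g I)) * p J.
  rewrite (eq_big_seq (fun J => (b0 - l * avg g I) * p J + l * g J)).
    rewrite big_split /= -!mulr_sumr -pD // -gD // mulrBl -mulrA avgK //; ring.
  move=> J JI; rewrite -[g J](avgK g J (Vc _ _ VI JI)); ring.
apply: ler_sum_child => // J JI VJ; rewrite -mulrDl ler_pM2r ?p_gt0 //.
exact: eb.
Qed.

(** * Square roots of the averages and their quadratic variation *)

Let rs I := Num.sqrt (avg s I).
Let rv I := Num.sqrt (avg v I).
Let r := Num.sqrt Q.

Let rs_gt0 I : V I -> 0 < rs I.
Proof. by move=> VI; rewrite sqrtr_gt0 avg_gt0. Qed.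
Let rv_gt0 I : V I -> 0 < rv I.
Proof. by move=> VI; rewrite sqrtr_gt0 avg_gt0. Qed.
Let rs2 I : V I -> avg s I = rs I ^+ 2.
Proof. by move=> VI; rewrite sqr_sqrtr // ltW // avg_gt0. Qed.
Let rv2 I : V I -> avg v I = rv I ^+ 2.
Proof. by move=> VI; rewrite sqr_sqrtr // ltW // avg_gt0. Qed.
Let r2 I : V I -> Q = r ^+ 2.
Proof. by move=> /Q_ge1 Q1; rewrite sqr_sqrtr //; lra. Qed.
Let rvs I : V I -> rv I * rs I <= r.
Proof.
move=> VI; rewrite /rv /rs -sqrtrM; last by rewrite ltW // avg_gt0.
by rewrite ler_wsqrtr // avg_vs_le.
Qed.

Lemma sqrt_max (x y : R) : Num.sqrt (Num.max x y) = Num.max (Num.sqrt x) (Num.sqrt y).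
Proof.
have [xy|yx] := leP x y; first by rewrite max_r ?ler_wsqrtr.
by rewrite max_l ?ler_wsqrtr // ltW.
Qed.

(** While [m] stays, concavity of the root pays for the squared difference. When [m] jumps to the
    new average, the Bellman function is zero there, and the remaining defect
    [2 * q * a * (b - q * a)] has the right sign. *)
Lemma sqrt_s_step (m : R) I : V I -> avg s I <= m ->
  \sum_(J <- c I) ((rs J - rs I) ^+ 2 * p J +
     (2 * Num.sqrt (Num.max m (avg s J)) * rs J - 2 * Num.max m (avg s J)) * p J)
  <= (2 * Num.sqrt m * rs I - 2 * m) * p I.
Proof.
move=> VI sm; have s0 : 0 < avg s I by exact: avg_gt0.
have a0 := rs_gt0 I VI; have a2 := rs2 I VI.
set a := rs I in a0 a2 *; set y := Num.sqrt m.
have m2 : m = y ^+ 2 by rewrite sqr_sqrtr //; lra.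
have ay : a <= y by rewrite ler_wsqrtr.
(* [q] is the slope of [2 * sqrt m * sqrt s] in [s] at the average over [I]. *)
have [q yq] : exists q, y = q * a by exists (y / a); rewrite divfK // gt_eqF.
have q1 : 1 <= q by rewrite -(ler_pM2r a0) mul1r -yq.
apply: (Bellman_step _ _ s _ q) => // J VJ _.
have b0 := rs_gt0 J VJ; rewrite sqrt_max (rs2 J) // (rs2 I) //.
rewrite sqrtr_sqr (ger0_norm (ltW b0)) -/a -/y m2.
set b := rs J in b0 *.
have [by_|yb] := leP b y.
  rewrite max_l ?ler_sqr ?nnegrE ?(ltW b0) ?(le_trans (ltW a0)) // yq.
  have : 0 <= (q - 1) * (b - a) ^+ 2 by rewrite mulr_ge0 ?sqr_ge0 ?subr_ge0.
  lra.
rewrite max_r ?ler_sqr ?nnegrE ?(ltW b0) ?(ltW yb) ?(le_trans (ltW a0)) //.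
rewrite yq in yb *.
have : 0 <= (q - 1) * (b - a) ^+ 2 by rewrite mulr_ge0 ?sqr_ge0 ?subr_ge0.
have : 0 <= q * a * (b - q * a).
  by rewrite !mulr_ge0 ?subr_ge0 ?(ltW yb) ?(ltW a0) ?(le_trans ler01 q1).
lra.
Qed.

Lemma sqrt_s_variation k I : V I ->
  path_sum (fun I J => (rs J - rs I) ^+ 2 * p J) k I <= 2 * pathmax k (avg s I) I.
Proof.
move=> VI.
pose B m I := (2 * Num.sqrt m * rs I - 2 * m) * p I.
(* Initially [m] is the average over [I], and there [B] vanishes. *)
have -> : 2 * pathmax k (avg s I) I = B (avg s I) I + 2 * pathmax k (avg s I) I.
  rewrite /B -/(rs I) {2}rs2 //; ring.
apply: path_sum_pathmax => // {}k {VI}I VI sk; last exact: sqrt_s_step.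
rewrite /B -mulrDl mulr_ge0 ?(ltW (p_gt0 I VI)) //.
have := rs_gt0 I VI; have := sqrtr_ge0 k.
move=> x0 y0; have : 0 <= Num.sqrt k * rs I by rewrite mulr_ge0 // ltW.
lra.
Qed.

(** The tangent slope in [v] is [z * y ^+ 3], which dominates the weight [avg s I ^+ 2 = a ^+ 4]. At
    a jump, [sqrt v <= r / sqrt m] for the new [m] makes the increase caused by [sqrt m ^+ 3] at
    most that of [3 * Q * m]. *)
Lemma sqrt_v_step (m : R) I : V I -> avg s I <= m ->
  \sum_(J <- c I) (avg s I ^+ 2 * (rv J - rv I) ^+ 2 * p J +
     (2 * r * Num.sqrt (Num.max m (avg s J)) ^+ 3 * rv J
      - 3 * Q * Num.max m (avg s J)) * p J)
  <= (2 * r * Num.sqrt m ^+ 3 * rv I - 3 * Q * m) * p I.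
Proof.
move=> VI sm; have s0 : 0 < avg s I by exact: avg_gt0.
have a0 := rs_gt0 I VI; have a2 := rs2 I VI.
have u0 := rv_gt0 I VI; have u2 := rv2 I VI; have au := rvs I VI.
rewrite (r2 I VI).
have r0 : 0 < r by apply: lt_le_trans au; rewrite mulr_gt0.
set a := rs I in a0 a2 au *; set u := rv I in u0 u2 au *; set y := Num.sqrt m.
have m2 : m = y ^+ 2 by rewrite sqr_sqrtr //; lra.
have ay : a <= y by rewrite ler_wsqrtr.
have y0 : 0 < y by exact: lt_le_trans ay.
have [z rz] : exists z, r = z * u by exists (r / u); rewrite divfK // gt_eqF.
have az : a <= z by rewrite -(ler_pM2r u0) -rz mulrC.
have za : a ^+ 4 <= z * y ^+ 3.
  rewrite exprS ler_pM ?exprn_ge0 ?(ltW a0) // lerXn2r // nnegrE ltW //.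
apply: (Bellman_step _ _ v _ (z * y ^+ 3)) => // J VJ _.
have b0 := rs_gt0 J VJ; have t0 := rv_gt0 J VJ; have tb := rvs J VJ.
rewrite sqrt_max (rs2 J) // a2 (rv2 J) // u2.
rewrite sqrtr_sqr (ger0_norm (ltW b0)) -/y m2.
set b := rs J in b0 tb *; set t := rv J in t0 tb *.
have main : a ^+ 4 * (t - u) ^+ 2 <= z * y ^+ 3 * (t - u) ^+ 2.
  by rewrite ler_wpM2r ?sqr_ge0.
have nochange : (a ^+ 2) ^+ 2 * (t - u) ^+ 2 + 2 * r * y ^+ 3 * t
    <= 2 * r * y ^+ 3 * u + z * y ^+ 3 * (t ^+ 2 - u ^+ 2).
  rewrite rz -exprM; lra.
have [by_|yb] := leP b y.
  rewrite max_l ?ler_sqr ?nnegrE ?(ltW b0) ?(ltW y0) //.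
  lra.
rewrite max_r ?ler_sqr ?nnegrE ?(ltW b0) ?(ltW yb) ?(ltW y0) //.
(* Multiplied by [b] and with [t * b <= r], this reduces to [(b - y) ^+ 2 * (b + 2 * y) >= 0]. *)
suff : 2 * (b ^+ 3 - y ^+ 3) * t <= 3 * r * (b ^+ 2 - y ^+ 2).
  by move=> /(ler_wpM2l (ltW r0)); lra.
rewrite -(ler_pM2r b0).
apply: (@le_trans _ _ (2 * (b ^+ 3 - y ^+ 3) * r)).
  rewrite -[leLHS]mulrA ler_wpM2l // mulr_ge0 // subr_ge0 lerXn2r // ?nnegrE ltW //.
suff : 0 <= r * ((b - y) ^+ 2 * (b + 2 * y)) by lra.
rewrite !mulr_ge0 ?sqr_ge0 //; lra.
Qed.

Lemma sqrt_v_variation k I : V I ->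
  path_sum (fun I J => avg s I ^+ 2 * (rv J - rv I) ^+ 2 * p J) k I
  <= 3 * Q * pathmax k (avg s I) I.
Proof.
move=> VI.
pose B m I := (2 * r * Num.sqrt m ^+ 3 * rv I - 3 * Q * m) * p I.
apply: (@le_trans _ _ (B (avg s I) I + 3 * Q * pathmax k (avg s I) I)).
  apply: path_sum_pathmax => // {}k {VI}I VI sk; last exact: sqrt_v_step.
  rewrite /B -mulrDl mulr_ge0 ?(ltW (p_gt0 I VI)) //.
  have -> : 2 * r * Num.sqrt k ^+ 3 * rv I - 3 * Q * k + 3 * Q * k =
    2 * r * Num.sqrt k ^+ 3 * rv I by ring.
  by rewrite !mulr_ge0 ?exprn_ge0 ?sqrtr_ge0.
(* The starting value of [B] is nonpositive because [rv I * rs I <= r]. *)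
rewrite gerDr /B -/(rs I) (r2 I VI) rs2 // mulr_le0_ge0 ?(ltW (p_gt0 I VI)) //.
have a0 := rs_gt0 I VI; have u0 := rv_gt0 I VI; have au := rvs I VI.
have -> : 2 * r * rs I ^+ 3 * rv I - 3 * r ^+ 2 * rs I ^+ 2 =
  - (r * rs I ^+ 2) * (2 * (r - rv I * rs I) + r) by ring.
rewrite mulNr oppr_le0 !mulr_ge0 ?sqr_ge0 ?sqrtr_ge0 //.
by have := sqrtr_ge0 Q; rewrite -/r; lra.
Qed.

(** For fixed [m], [g m] is additive over children. A jump from [m] to [y] raises its average by at
    most [y - m], since [(y + m) * avg v <= 2 * Q]. At the end, AM-GM with [1 <= avg v * avg s]
    bounds that average below by [2 * m]. *)
Lemma pathmax_le k I : V I -> pathmax k 0 I <= 2 * Q * s I.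
Proof.
move=> VI; rewrite pathmax0 //; have Q1 := Q_ge1 _ VI.
have Q0 : 0 < Q by lra.
pose g m I := m ^+ 2 / (2 * Q) * v I + 2 * Q * s I.
have gE m J : V J -> avg (g m) J = m ^+ 2 / (2 * Q) * avg v J + 2 * Q * avg s J.
  by move=> VJ; rewrite /avg /g mulrDl !mulrA.
pose B m I := g m I - m * p I.
(* Zero edge terms and [a = - 1] turn the Bellman scheme into an upper bound for [pathmax]
   itself. *)
have : path_sum (fun I J => 0 * p J) k I <= B (avg s I) I + (- 1) * pathmax k (avg s I) I.
  apply: path_sum_pathmax => // {k}m {VI}I VI sm.
    rewrite /B -[g m I](avgK (g m) I VI) gE // -mulrBl -mulrDl.
    rewrite mulr_ge0 ?(ltW (p_gt0 I VI)) //.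
    have := avg_vs_ge I VI; have := avg_gt0 s I VI s_gt0.
    have := avg_gt0 v I VI v_gt0.
    set x := avg v I; set y := avg s I in sm *; move=> x0 y0 xy.
    have -> : m ^+ 2 / (2 * Q) * x + 2 * Q * y - m + -1 * m =
      ((x * m - 2 * Q) ^+ 2 + (2 * Q) ^+ 2 * (x * y - 1)) / (2 * Q * x).
      by field; rewrite !gt_eqF.
    rewrite divr_ge0 ?addr_ge0 ?sqr_ge0 // mulr_ge0 ?sqr_ge0 ?subr_ge0 ?(ltW x0) //.
    by rewrite mulr_ge0 // ltW.
  rewrite {2}/B -[g m I](avgK (g m) I VI) -mulrBl.
  rewrite (eq_big_seq (fun J => 0 * p J + (avg (g (Num.max m (avg s J))) J - Num.max m (avg s J)) * p J)); last first.
    by move=> J /Vc VJ; rewrite mulrBl avgK //; exact: VJ VI.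
  apply: (Bellman_step _ _ (g m) _ 1) => //.
    by move=> J VJ; rewrite /g vD // sD // !mulr_sumr -big_split.
  move=> J VJ _; rewrite !gE // mul1r.
  have := avg_vs_le J VJ; have := avg_gt0 s J VJ s_gt0.
  have := avg_gt0 v J VJ v_gt0; have := avg_gt0 s I VI s_gt0.
  set x := avg v J; set y := avg s J; move=> si x0 y0 xy.
  have [ym|my] := leP y m; first lra.
  suff : (y ^+ 2 - m ^+ 2) / (2 * Q) * x <= y - m by lra.
  rewrite mulrAC ler_pdivrMr; last lra.
  have : (y + m) * x <= 2 * Q by have := ler_wpM2r (ltW x0) (ltW my); lra.
  have : 0 <= y - m by lra.
  move=> /ler_wpM2l h /h; lra.
have -> : path_sum (fun _ J => 0 * p J) k I = 0.
  elim: k I {VI} => //= k IH I.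
  by rewrite big1_seq // => J _; rewrite IH mul0r addr0.
rewrite mulN1r subr_ge0 => /le_trans; apply.
have := avg_vs_le I VI; have := avg_gt0 s I VI s_gt0; have p0 := p_gt0 I VI.
have := avgK v I VI; have := avgK s I VI; rewrite /B /g.
move: (avg v I) (avg s I) => x y <- <- y0 xy.
suff : y ^+ 2 / (2 * Q) * x <= y by move=> /(ler_wpM2r (ltW p0)); lra.
rewrite mulrAC ler_pdivrMr; last lra.
have := ler_wpM2l (ltW y0) xy; have := mulr_gt0 y0 Q0; lra.
Qed.

(** * Carleson packing *)

Let e1 I J := (avg s J - avg s I) ^+ 2 * v J.

(** Let [a], [b] be the roots of the averages of [s] over [I], [J], and [u], [t] those of [v]. If
    [b >= a / 2], then [(b + a) * t <= 3 * q]. If [b < a / 2] and [a * t <= 2 * q], then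
    [a - b >= a / 2] and the first term suffices. Otherwise [a * u <= q] forces [2 * u < t], and the
    second one does. *)
Lemma Carleson_step I J : V I -> V J ->
  e1 I J <= 16 * Q * ((rs J - rs I) ^+ 2 * p J)
            + 4 * (avg s I ^+ 2 * (rv J - rv I) ^+ 2 * p J).
Proof.
move=> VI VJ; rewrite /e1 -(avgK v J VJ).
have p0 := p_gt0 J VJ.
have -> : 16 * Q * ((rs J - rs I) ^+ 2 * p J) +
    4 * (avg s I ^+ 2 * (rv J - rv I) ^+ 2 * p J) =
  (16 * Q * (rs J - rs I) ^+ 2 + 4 * (avg s I ^+ 2 * (rv J - rv I) ^+ 2)) * p J.
  ring.
rewrite mulrA ler_pM2r //.
have a0 := rs_gt0 I VI; have b0 := rs_gt0 J VJ.
have u0 := rv_gt0 I VI; have t0 := rv_gt0 J VJ.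
have au := rvs I VI; have bt := rvs J VJ.
rewrite (rs2 I VI) (rs2 J VJ) (rv2 J VJ) (r2 I VI).
move: (rs I) (rs J) (rv I) (rv J) r a0 b0 u0 t0 au bt => a b u t q.
move=> a0 b0 u0 t0 au bt.
have q0 : 0 < q by apply: lt_le_trans au; rewrite mulr_gt0.
have A0 : 0 <= 16 * q ^+ 2 * (b - a) ^+ 2.
  by rewrite mulr_ge0 ?sqr_ge0 // mulr_ge0 ?sqr_ge0.
have B0 : 0 <= (a ^+ 2) ^+ 2 * (t - u) ^+ 2 by rewrite mulr_ge0 ?sqr_ge0.
have [ab|ba] := leP (a / 2) b.
  have : ((b + a) * t) ^+ 2 <= (3 * q) ^+ 2.
    rewrite lerXn2r ?nnegrE ?mulr_ge0 ?addr_ge0 ?(ltW a0) ?(ltW b0) ?(ltW t0) ?(ltW q0) //.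
    by have : (b + a) * t <= 3 * b * t; [rewrite ler_pM2r //|]; lra.
  move=> /(ler_wpM2l (sqr_ge0 (b - a))).
  have : 0 <= q ^+ 2 * (b - a) ^+ 2 by rewrite mulr_ge0 ?sqr_ge0.
  lra.
have b2 : (b ^+ 2 - a ^+ 2) ^+ 2 <= (a ^+ 2) ^+ 2.
  rewrite -[leLHS]sqrrN lerXn2r ?nnegrE ?sqr_ge0 // opprB ?gerBl ?sqr_ge0 //.
  rewrite subr_ge0 lerXn2r ?nnegrE ?(ltW b0) ?(ltW a0) //; lra.
have := ler_wpM2r (sqr_ge0 t) b2.
have [at_|at_] := leP (a * t) (2 * q).
  have : (a * t) ^+ 2 <= (2 * q) ^+ 2.
    by rewrite lerXn2r ?nnegrE ?mulr_ge0 ?(ltW a0) ?(ltW t0) ?(ltW q0).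
  move=> /(ler_wpM2l (sqr_ge0 a)).
  have : (a / 2) ^+ 2 <= (a - b) ^+ 2.
    by rewrite lerXn2r ?nnegrE //; lra.
  move=> /(ler_wpM2l (sqr_ge0 q)).
  lra.
have ut : t / 2 <= t - u.
  by have : 2 * u < t; [rewrite -(ltr_pM2l a0)|]; lra.
have : (t / 2) ^+ 2 <= (t - u) ^+ 2.
  by rewrite lerXn2r ?nnegrE //; lra.
move=> /(ler_wpM2l (sqr_ge0 (a ^+ 2))).
lra.
Qed.

(** The two variation bounds enter with [16 * 2 + 4 * 3 = 44]. *)
Lemma Carleson_packing k I : V I -> path_sum e1 k I <= 44 * Q * pathmax k 0 I.
Proof.
move=> VI; rewrite pathmax0 //.
apply: le_trans (path_sum_le _ _ k I VI (fun I J VI VJ _ => Carleson_step I J VI VJ)) _.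
rewrite path_sum_lin.
have := sqrt_s_variation k I VI; have := sqrt_v_variation k I VI.
have Q1 := Q_ge1 _ VI.
have Q0 : 0 <= 16 * Q by lra.
move=> h /(ler_wpM2l Q0); lra.
Qed.

(** * The square function on the tree *)

Variables (F G : X -> R).
Hypothesis FD : forall I, V I -> F I = \sum_(J <- c I) F J.
Hypothesis GD : forall I, V I -> G I = \sum_(J <- c I) G J.
Hypothesis F_le_Gs : forall I, V I -> F I ^+ 2 <= G I * s I.
(** [K] stays free: [2 * Q] gives the second estimate, [[u]_infty] the first. *)
Variables (K : R).
Hypothesis pathmax_K : forall k I, V I -> pathmax k 0 I <= K * s I.

Let L := 44 * Q * K.
(** The packing mass is normalized to at most [s I], so [A] lies between [s] and [2 * s]. *)
Let A k I := s I + path_sum e1 k I / L.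

Let K_ge1 I : V I -> 1 <= K.
Proof.
move=> VI; have := pathmax_K 0 _ VI; rewrite pathmax0 //= maxxx avgK //.
by rewrite -{1}[s I]mul1r ler_pM2r // s_gt0.
Qed.

Let L_gt0 I : V I -> 0 < L.
Proof.
by move=> VI; rewrite !mulr_gt0 //; [have := Q_ge1 _ VI|have := K_ge1 _ VI]; lra.
Qed.

Let e1_ge0 k I : V I -> 0 <= path_sum e1 k I.
Proof.
elim: k I => //= k IH I VI; rewrite big_seq; apply: sumr_ge0 => J /(Vc _ _ VI) VJ.
by rewrite addr_ge0 ?IH // mulr_ge0 ?sqr_ge0 // ltW // v_gt0.
Qed.

Let e1_le k I : V I -> path_sum e1 k I <= L * s I.
Proof.
move=> VI; apply: le_trans (Carleson_packing k I VI) _.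
rewrite /L -[leRHS]mulrA; apply: ler_wpM2l (pathmax_K _ _ VI).
by have := Q_ge1 _ VI; lra.
Qed.

Let A_gt0 k I : V I -> 0 < A k I.
Proof.
move=> VI; rewrite ltr_wpDr ?s_gt0 // divr_ge0 ?e1_ge0 // ltW //; exact: L_gt0 VI.
Qed.

(** Convexity through tangents: [a ^+ 2 / b >= 2 * th * a - th ^+ 2 * b], where [th] is the ratio of
    the two sums. *)
Lemma sum_sqr_div (a b : X -> R) I : V I -> (forall J, V J -> 0 < b J) ->
  0 < \sum_(J <- c I) b J ->
  (\sum_(J <- c I) a J) ^+ 2 / (\sum_(J <- c I) b J)
  <= \sum_(J <- c I) a J ^+ 2 / b J.
Proof.
move=> VI b0; set SA := \sum_(J <- c I) a J; set SB := \sum_(J <- c I) b J => B0.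
pose th := SA / SB.
have -> : SA ^+ 2 / SB = \sum_(J <- c I) (2 * th * a J - th ^+ 2 * b J).
  rewrite big_split /= sumrN -!mulr_sumr -/SA -/SB /th; field.
  by rewrite gt_eqF.
apply: ler_sum_child => // J JI VJ; have bJ := b0 J VJ.
rewrite ler_pdivlMr // -subr_ge0.
have -> : a J ^+ 2 - (2 * th * a J - th ^+ 2 * b J) * b J = (a J - th * b J) ^+ 2 by ring.
exact: sqr_ge0.
Qed.

(** The first part pays for the differences relative to [s], the second for the embedding. The
    factor [8 * L] turns the one-step gain [th ^+ 2 * al / (4 * L)] into the required
    [2 * th ^+ 2 * al]. *)
Let B k I := 2 * Q * (G I - F I ^+ 2 / s I) + 8 * L * (G I - F I ^+ 2 / A k I).

Lemma square_function_step k I : V I ->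
  \sum_(J <- c I) ((avg F J - avg F I) ^+ 2 * v J + B k J) <= B k.+1 I.
Proof.
move=> VI.
have L0 := L_gt0 I VI; have s0 := s_gt0 I VI; have Q1 := Q_ge1 I VI.
have Q0 : 0 < Q by lra.
pose th := F I / s I.
pose al := \sum_(J <- c I) e1 I J.
have AS : \sum_(J <- c I) A k J = A k.+1 I - al / L.
  rewrite /A big_split /= -sD // -mulr_suml big_split /= -/al; field.
  by rewrite gt_eqF.
have AS0 : 0 < \sum_(J <- c I) A k J.
  apply: lt_le_trans s0 _; rewrite sD //; apply: ler_sum_child => // J JI VJ.
  by rewrite lerDl divr_ge0 ?e1_ge0 // ltW.
have al0 : 0 <= al.
  rewrite /al big_seq; apply: sumr_ge0 => J /(Vc _ _ VI) VJ.
  by rewrite mulr_ge0 ?sqr_ge0 // ltW // v_gt0.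
have A2 : A k.+1 I <= 2 * s I.
  by rewrite /A mulr_natl mulr2n lerD2l ler_pdivrMr // mulrC e1_le.
(* Passing to the children removes [al / L] from the total of [A]. The convexity bound grows
   accordingly, and [A k.+1 I <= 2 * s I] bounds the growth from below. *)
have embed : F I ^+ 2 / A k.+1 I + th ^+ 2 * al / (4 * L) <= \sum_(J <- c I) F J ^+ 2 / A k J.
  apply: le_trans (sum_sqr_div F (A k) I VI (A_gt0 k) AS0).
  rewrite -FD // AS; rewrite AS in AS0.
  have := A_gt0 k.+1 I VI; move: (A k.+1 I) AS0 A2 => a a1 a2 a0.
  rewrite -subr_ge0.
  have -> : F I ^+ 2 / (a - al / L) - (F I ^+ 2 / a + th ^+ 2 * al / (4 * L)) =
    th ^+ 2 * al / (4 * L) * (4 * s I ^+ 2 - a * (a - al / L)) / (a * (a - al / L)).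
    by rewrite /th; field; rewrite !gt_eqF //; move: a1; rewrite -(ltr_pM2l L0) mulr0 mulrBr mulrCA divff ?gt_eqF // mulr1; lra.
  have L4 : 0 <= 4 * L by lra.
  rewrite divr_ge0 ?(ltW (mulr_gt0 a0 a1)) // mulr_ge0 //.
    by rewrite divr_ge0 // mulr_ge0 // sqr_ge0.
  rewrite subr_ge0; have alL : 0 <= al / L by rewrite divr_ge0 // ltW.
  apply: (@le_trans _ _ (a * a)); first by rewrite ler_wpM2l // ?(ltW a0) // gerBl.
  have : a * a <= (2 * s I) * (2 * s I) by rewrite ler_pM ?(ltW a0).
  lra.
(* This is the variance identity for the ratios [F / s] under the masses [s], with mean [th]. *)
have pyth : \sum_(J <- c I) (F J - th * s J) ^+ 2 / s J =
    \sum_(J <- c I) F J ^+ 2 / s J - F I ^+ 2 / s I.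
  transitivity (\sum_(J <- c I) (F J ^+ 2 / s J + (- (2 * th) * F J + th ^+ 2 * s J))).
    apply: eq_big_seq => J /(Vc _ _ VI) VJ; field; by rewrite gt_eqF ?s_gt0.
  rewrite !big_split /= -!mulr_sumr -FD // -sD // /th; field; by rewrite gt_eqF.
(* The square of a sum is at most twice the sum of the squares, and [v J / p J ^+ 2 <= Q / s J]
   handles the first one. *)
have term J : J \in c I -> V J -> (avg F J - avg F I) ^+ 2 * v J <=
    2 * Q * ((F J - th * s J) ^+ 2 / s J) + 2 * th ^+ 2 * e1 I J.
  move=> _ VJ; have pJ := p_gt0 J VJ; have pI := p_gt0 I VI; have sJ := s_gt0 J VJ.
  have -> : avg F J - avg F I = (F J - th * s J) / p J + th * (avg s J - avg s I).
    by rewrite /avg /th; field; rewrite !gt_eqF.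
  set x := (F J - _); set y := avg s J - avg s I.
  have vJ : v J / p J ^+ 2 <= Q / s J.
    rewrite ler_pdivrMr ?exprn_gt0 // mulrAC ler_pdivlMr //; exact: vs_le_p.
  have := ler_wpM2l (sqr_ge0 x) vJ.
  have : 0 <= (x / p J - th * y) ^+ 2 * v J by rewrite mulr_ge0 ?sqr_ge0 // ltW // v_gt0.
  rewrite /e1 -/y => h1 h2.
  have -> : 2 * Q * (x ^+ 2 / s J) = 2 * (x ^+ 2 * (Q / s J)) by ring.
  have : (x / p J) ^+ 2 * v J = x ^+ 2 * (v J / p J ^+ 2) by rewrite expr_div_n; ring.
  lra.
rewrite big_split /=.
apply: le_trans (lerD (ler_sum_child _ _ _ VI term) (lexx _)) _.
rewrite /B !big_split /= -!mulr_sumr !big_split /= !sumrN -/al pyth -GD //.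
have := ler_wpM2l (ltW L0) embed.
have -> : L * (F I ^+ 2 / A k.+1 I + th ^+ 2 * al / (4 * L)) =
  L * (F I ^+ 2 / A k.+1 I) + th ^+ 2 * al / 4.
  by rewrite mulrDr; congr (_ + _); field; rewrite gt_eqF.
lra.
Qed.

(** The steps telescope to [B k I], since [F ^+ 2 <= G * s] keeps the final [B] nonnegative. The
    constant is [2 + 8 * 44 = 354], using [K >= 1]. *)
Lemma square_function_tree k I : V I ->
  path_sum (fun I J => (avg F J - avg F I) ^+ 2 * v J) k I <= 354 * Q * K * G I.
Proof.
move=> VI.
have pos a J : V J -> 0 < a -> s J <= a -> 0 <= G J - F J ^+ 2 / a.
  move=> VJ a0 sa; rewrite subr_ge0 ler_pdivrMr //.
  apply: le_trans (F_le_Gs _ VJ) _; apply: ler_wpM2l => //.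
  by rewrite -(ler_pM2r (s_gt0 _ VJ)) mul0r (le_trans _ (F_le_Gs _ VJ)) // sqr_ge0.
have Q1 := Q_ge1 _ VI; have K1 := K_ge1 _ VI.
apply: (@le_trans _ _ (B k I)).
  elim: k I VI {Q1 K1} => [|k IH] I VI /=.
    have Q1 := Q_ge1 _ VI; have L0 := L_gt0 I VI.
    by rewrite addr_ge0 // mulr_ge0 ?pos ?s_gt0 ?A_gt0 //; try lra; rewrite /A mul0r addr0.
  apply: le_trans (square_function_step k I VI); apply: ler_sum_child => // J JI VJ.
  by rewrite lerD2l IH.
have L0 := L_gt0 I VI.
have G0 : 0 <= G I.
  rewrite -(ler_pM2r (s_gt0 _ VI)) mul0r (le_trans _ (F_le_Gs _ VI)) ?sqr_ge0 //.
have h1 : G I - F I ^+ 2 / s I <= G I by rewrite gerBl divr_ge0 ?sqr_ge0 // ltW ?s_gt0.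
have h2 : G I - F I ^+ 2 / A k I <= G I by rewrite gerBl divr_ge0 ?sqr_ge0 // ltW ?A_gt0.
have Q2 : 0 <= 2 * Q by lra.
have L2 : 0 <= 8 * L by lra.
apply: le_trans (lerD (ler_wpM2l Q2 h1) (ler_wpM2l L2 h2)) _.
rewrite /L.
have := mulr_ge0 (mulr_ge0 (le_trans ler01 Q1) G0) (_ : 0 <= K - 1).
rewrite subr_ge0 => /(_ K1); lra.
Qed.

End TreeCarleson.

(** * Atoms *)

(** The sets that split no member of [G] form a sigma-algebra, which contains [G] by
    disjointness. *)
Lemma sub_or_disjoint_sigma {T : Type} (G : set (set T)) (B : set T) :
  trivIset G id -> <<s G >> B -> forall J, G J -> J `<=` B \/ J `<=` ~` B.
Proof.
move=> tG; apply: (smallest_sub (X := [set B | forall J, G J -> J `<=` B \/ J `<=` ~` B])).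
  split => /=.
  - by move=> J _; right => x _ [].
  - by move=> A HA J /HA[JA|JA]; [right => x /JA Ax [_]|left => x /JA].
  - move=> A HA J GJ; have [[n JAn]|nJ] := pselect (exists n, J `<=` A n).
      by left => x /JAn Anx; exists n.
    right => x Jx [n _ Anx]; have [JAn|/(_ _ Jx)//] := HA n J GJ.
    by apply: nJ; exists n.
move=> B' GB' J GJ /=; have [->|JB'] := pselect (J = B'); first by left.
right => x Jx B'x; apply: JB'; apply: tG => //; by exists x.
Qed.

(** * Integrals over finite partitions *)

Section integral_seq.
Context {d : measure_display} {T : measurableType d} {R : realType}.
Variable P : {measure set T -> \bar R}.
Variables (s : seq (set T)) (A : set T).
Hypothesis us : uniq s.
Hypothesis ts : trivIset [set` s] id.
Hypothesis ms : forall J, J \in s -> measurable J.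
Hypothesis As : A = \bigcup_(J in [set` s]) J.

(** Empty off [s], so that it is measurable at every index. *)
Let F J : set T := if J \in s then J else set0.

Let mF J : measurable (F J).
Proof. by rewrite /F; case: ifP => // /ms. Qed.

Let tF : trivIset [set` s] F.
Proof. by move=> I J /= Is Js; rewrite /F Is Js; exact: ts. Qed.

Let AF : A = \big[setU/set0]_(J <- s) F J.
Proof.
rewrite As -bigcup_seq; apply: eq_bigcupr => J /= Js; by rewrite /F Js.
Qed.

Lemma ge0_integral_seq (f : T -> \bar R) : measurable_fun A f ->
  (forall x, A x -> 0 <= f x)%E ->
  (\int[P]_(x in A) f x = \sum_(J <- s) \int[P]_(x in J) f x)%E.
Proof.
rewrite AF => mf f0; rewrite ge0_integral_bigsetU //.
by apply: eq_big_seq => J Js; rewrite /F Js.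
Qed.

Lemma integral_seq_EFin (f : T -> R) : measurable_fun A (EFin \o f) ->
  (\int[P]_(x in A) (f x)%:E = \sum_(J <- s) \int[P]_(x in J) (f x)%:E)%E.
Proof.
rewrite AF => mf; rewrite integral_bigsetU_EFin //.
by apply: eq_big_seq => J Js; rewrite /F Js.
Qed.

End integral_seq.

(** The inverse is written through a power of the nonnegative [w ^+ 2]; at zeros of [w] both sides
    are 0. *)
Lemma measurable_fun_invr {d} {T : measurableType d} {R : realType} (w : T -> R) :
  measurable_fun setT w -> measurable_fun setT (fun x => (w x)^-1).
Proof.
move=> mw; have -> : (fun x => (w x)^-1) = (fun x => w x * (w x ^+ 2) `^ (- 1)).
  apply/funext => x; rewrite powR_inv1 ?sqr_ge0 //.
  have [->|wx] := eqVneq (w x) 0; first by rewrite invr0 mul0r.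
  by rewrite expr2 invfM mulrA mulfV // mul1r.
apply: measurable_funM => //.
apply: (measurableT_comp (measurable_powR (-1))).
exact: measurable_funX.
Qed.

Section AtomicFiltration.
Context {d : measure_display} {T : measurableType d} {R : realType}.
Variables (P : probability T R) (D : nat -> set (set T)).
Hypothesis PD : atomic_filtration P D.

Let finD n : finite_set (D n). Proof. by case: PD. Qed.
Lemma measurable_atom n I : D n I -> measurable I.
Proof. by case: PD => _ [/(_ n I) + _] DI => /(_ DI)[]. Qed.
Lemma atom_gt0 n I : D n I -> (0 < P I)%E.
Proof. by case: PD => _ [/(_ n I) + _] DI => /(_ DI)[]. Qed.
Lemma trivIset_atoms n : trivIset (D n) id.
Proof. by case: PD => _ [_ [+ _]]. Qed.
Lemma atoms_cover n x : exists2 I, D n I & I x.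
Proof.
case: PD => _ [_ [_ [+ _]]] => /(_ n)/seteqP[_ /(_ x I)[I DI Ix]]; by exists I.
Qed.
Lemma atoms0 : D 0%N = [set setT].
Proof. by case: PD => _ [_ [_ [_ []]]]. Qed.

Lemma atom_uniq n I J x : D n I -> D n J -> I x -> J x -> I = J.
Proof. by move=> DI DJ Ix Jx; apply: (trivIset_atoms n) => //; exists x. Qed.

(** [I] belongs to the sigma-algebra of the next generation, whose sets split no atom [J]. *)
Lemma atom_nested n I J x : D n I -> D n.+1 J -> I x -> J x -> J `<=` I.
Proof.
move=> DI DJ Ix Jx; case: PD => _ [_ [_ [_ [_ [sub _]]]]].
have : <<s D n.+1 >> I by apply: sub; exact: sub_sigma_algebra.
by move=> /(sub_or_disjoint_sigma _ _ (trivIset_atoms n.+1))/(_ _ DJ)[//|/(_ _ Jx)].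
Qed.

Lemma child_cover n I x : D n I -> I x -> exists2 J, ch D n I J & J x.
Proof.
move=> DI Ix; have [J DJ Jx] := atoms_cover n.+1 x.
exists J => //; split => //; exact: (atom_nested n I J x).
Qed.

Let fin_ch n I : finite_set (ch D n I).
Proof. by apply: sub_finite_set (finD n.+1) => J []. Qed.

Definition children (n : nat) (I : set T) : seq (set T) := finmap.enum_fset (fset_set (ch D n I)).

Lemma children_ch n I J : J \in children n I -> ch D n I J.
Proof. by rewrite /children in_fset_set // inE. Qed.

Lemma ch_children n I J : ch D n I J -> J \in children n I.
Proof. by rewrite /children in_fset_set // inE. Qed.

Lemma uniq_children n I : uniq (children n I).
Proof. exact: finmap.fset_uniq. Qed.

Lemma measurable_child n I J : J \in children n I -> measurable J.
Proof. by move=> /children_ch[/measurable_atom]. Qed.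

Lemma trivIset_children n I : trivIset [set` children n I] id.
Proof.
apply: sub_trivIset (trivIset_atoms n.+1) => J /=; by move=> /children_ch[].
Qed.

Lemma bigcup_children n I : D n I -> I = \bigcup_(J in [set` children n I]) J.
Proof.
move=> DI; apply/seteqP; split => x.
  by move=> /(child_cover n I x DI)[J JI Jx]; exists J => //; exact: ch_children.
by move=> [J /= /children_ch[_ JI] /JI].
Qed.

Lemma ge0_integral_children n I (f : T -> \bar R) : D n I ->
  measurable_fun setT f -> (forall x, 0 <= f x)%E ->
  (\int[P]_(x in I) f x = \sum_(J <- children n I) \int[P]_(x in J) f x)%E.
Proof.
move=> DI mf f0; apply: ge0_integral_seq => //.
- exact: uniq_children.
- exact: trivIset_children.
- exact: measurable_child.
- exact: bigcup_children.
- exact: measurable_funTS.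
Qed.

Lemma Rintegral_children n I (f : T -> R) : D n I ->
  P.-integrable setT (EFin \o f) ->
  \int[P]_(x in I) f x = \sum_(J <- children n I) \int[P]_(x in J) f x.
Proof.
move=> DI fi; rewrite /Rintegral (@integral_seq_EFin _ _ _ _ (children n I)).
- rewrite big_seq -sum_fine -?big_seq // => J /measurable_child mJ.
  by apply: integrable_fin_num => //; apply: integrableS fi.
- exact: uniq_children.
- exact: trivIset_children.
- exact: measurable_child.
- exact: bigcup_children.
- apply: measurable_funTS; exact: measurable_int fi.
Qed.

(** * The tree of atoms *)

Definition kids (x : nat * set T) : seq (nat * set T) :=
  [seq (x.1.+1, J) | J <- children x.1 x.2].

(** The generation is part of a node because one set may be an atom of several generations. *)
Definition node (x : nat * set T) : Prop := D x.1 x.2.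

Definition mass (f : T -> R) (x : nat * set T) : R := \int[P]_(y in x.2) f y.

Definition vol (x : nat * set T) : R := fine (P x.2).

Lemma node_kids x y : node x -> y \in kids x -> node y.
Proof. by move=> _ /mapP[J /children_ch[DJ _] ->]. Qed.

Lemma massD f x : P.-integrable setT (EFin \o f) -> node x ->
  mass f x = \sum_(y <- kids x) mass f y.
Proof. by move=> fi nx; rewrite big_map -Rintegral_children. Qed.

Lemma vol_mass x : node x -> vol x = mass (cst 1) x.
Proof. by move=> /(measurable_atom _ _) mx; rewrite /mass Rintegral_cst // mul1r. Qed.

Lemma integrable_cst1 : P.-integrable setT (EFin \o (cst 1 : T -> R)).
Proof. exact: finite_measure_integrable_cst. Qed.

Lemma volD x : node x -> vol x = \sum_(y <- kids x) vol y.
Proof.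
move=> nx; rewrite vol_mass // massD //; last exact: integrable_cst1.
by apply: eq_big_seq => y /node_kids ny; rewrite vol_mass //; exact: ny.
Qed.

Lemma vol_gt0 x : node x -> 0 < vol x.
Proof.
by move=> nx; rewrite /vol fine_gt0 // (atom_gt0 _ _ nx) /= ltey_eq fin_num_measure //; exact: measurable_atom nx.
Qed.

Lemma ravg_avg f x : ravg P x.2 f = avg vol (mass f) x.
Proof. by []. Qed.

Lemma eavg_avg f x : node x -> P.-integrable setT (EFin \o f) ->
  eavg P x.2 (EFin \o f) = (avg vol (mass f) x)%:E.
Proof.
move=> nx fi; have mx := measurable_atom _ _ nx.
rewrite /eavg /avg /mass EFinM fineK //; apply: integrable_fin_num => //.
by apply: integrableS fi.
Qed.

(* The discriminant of [2 * t * h - t ^+ 2 * w^-1 <= h ^+ 2 * w]. *)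
Lemma mass_Cauchy_Schwarz (h w : T -> R) x : node x -> (forall y, 0 < w y) ->
  P.-integrable setT (EFin \o h) ->
  P.-integrable setT (EFin \o (fun y => h y ^+ 2 * w y)) ->
  P.-integrable setT (EFin \o (fun y => (w y)^-1)) ->
  mass h x ^+ 2 <= mass (fun y => h y ^+ 2 * w y) x * mass (fun y => (w y)^-1) x.
Proof.
move=> nx w0 hi hwi wi.
have mx := measurable_atom _ _ nx.
have [hi' hwi' wi'] : [/\ P.-integrable x.2 (EFin \o h),
  P.-integrable x.2 (EFin \o (fun y => h y ^+ 2 * w y)) &
  P.-integrable x.2 (EFin \o (fun y => (w y)^-1))].
  by split; [apply: integrableS hi|apply: integrableS hwi|apply: integrableS wi].
have lin t : 2 * t * mass h x - t ^+ 2 * mass (fun y => (w y)^-1) x <=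
    mass (fun y => h y ^+ 2 * w y) x.
  have iZ a g : P.-integrable x.2 (EFin \o g) -> P.-integrable x.2 (EFin \o (fun y => a * g y)).
    by move=> gi; exact: (integrableZl mx a gi).
  have i1 : P.-integrable x.2 (EFin \o (fun y => 2 * t * h y)).
    exact: iZ.
  have i2 : P.-integrable x.2 (EFin \o (fun y => t ^+ 2 * (w y)^-1)).
    exact: iZ.
  rewrite /mass -!RintegralZl // -RintegralB //; apply: le_Rintegral => //.
    exact: (integrableB mx i1 i2).
  move=> y _; rewrite -subr_ge0.
  have -> : h y ^+ 2 * w y - (2 * t * h y - t ^+ 2 * (w y)^-1) = (h y * w y - t) ^+ 2 / w y.
    by field; rewrite gt_eqF.
  by rewrite divr_ge0 ?sqr_ge0 // ltW.
have : 0 <= mass (fun y => (w y)^-1) x.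
  by apply: Rintegral_ge0 => y _; rewrite invr_ge0 ltW.
move: lin; set a := mass h x; set c := mass _ x; set b := mass _ x.
move: a b c => a b c lin; rewrite le_eqVlt => /predU1P[c0|c0].
  have [->|a0] := eqVneq a 0.
    by rewrite -c0 mulr0 expr0n.
  have := lin ((b + 1) / (2 * a)); rewrite -c0 mulr0 subr0.
  have -> : 2 * ((b + 1) / (2 * a)) * a = b + 1 by field.
  by rewrite gerDl ler10.
have := lin (a / c).
have -> : 2 * (a / c) * a - (a / c) ^+ 2 * c = a ^+ 2 / c by field; rewrite gt_eqF.
by rewrite ler_pdivrMr.
Qed.

Lemma atom_nested_le n k I J x : (n <= k)%N -> D n I -> D k J -> I x -> J x ->
  J `<=` I.
Proof.
move=> nk DI + Ix; rewrite -(subnKC nk); move: (k - n)%N => {nk}j.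
elim: j J => [|j IH] J; first by rewrite addn0 => DJ Jx; rewrite (atom_uniq _ _ _ _ DJ DI Jx Ix).
rewrite addnS => DJ Jx; have [K DK Kx] := atoms_cover (n + j) x.
by apply: subset_trans (IH K DK Kx); apply: atom_nested DK DJ Kx Jx.
Qed.

(** * Measurability and integrals of the square function *)

Lemma measurable_sum_seq (s : seq (set T)) (h : set T -> T -> R) :
  (forall J, J \in s -> measurable_fun setT (h J)) ->
  measurable_fun setT (fun x => \sum_(J <- s) h J x).
Proof.
move=> hs; under eq_fun do rewrite big_tnth.
by apply: measurable_sum => i; apply: hs; exact: mem_tnth.
Qed.

Lemma measurable_fsum_atoms n (C : set (set T)) (h : set T -> T -> R) :
  C `<=` D n ->
  (forall J, D n J -> measurable_fun setT (h J)) ->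
  measurable_fun setT (fun x => \sum_(J \in C) h J x).
Proof.
move=> CD mh; have finC : finite_set C by apply: sub_finite_set (finD n).
under eq_fun do rewrite fsbig_finite //.
by apply: measurable_sum_seq => J; rewrite in_fset_set // inE => /CD; exact: mh.
Qed.

Lemma measurable_Delta n I f : D n I -> measurable_fun setT (Delta P D n I f).
Proof.
move=> DI; apply: measurable_funB.
  apply: (measurable_fsum_atoms n.+1) => [J []//|J /measurable_atom mJ].
  by apply: measurable_funM => //; exact: measurable_indic.
by apply: measurable_funM => //; apply: measurable_indic; exact: measurable_atom DI.
Qed.

Definition sqdiff n f x : R := \sum_(I \in D n) (Delta P D n I f x) ^+ 2.

Lemma sqdiff_ge0 n f x : 0 <= sqdiff n f x.
Proof.
by rewrite /sqdiff fsbig_finite // sumr_ge0 // => I _; exact: sqr_ge0.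
Qed.

Lemma measurable_sqdiff n f : measurable_fun setT (sqdiff n f).
Proof.
apply: (measurable_fsum_atoms n) => // J DJ; apply: measurable_funX.
exact: measurable_Delta.
Qed.

Lemma sum_atoms (n : nat) (C : set (set T)) (h : set T -> R) J x :
  C `<=` D n -> C J -> J x -> \sum_(K \in C) (\1_K x) * h K = h J.
Proof.
move=> CD CJ Jx; have finC : finite_set C by apply: sub_finite_set (finD n).
rewrite (fsbigD1 J) //= indicE mem_set // mul1r fsbig1 ?addr0 // => K [/= CK KJ].
rewrite indicE memNset ?mul0r // => Kx; apply: KJ.
by apply: (atom_uniq n _ _ x) => //; exact: CD.
Qed.

Lemma sqdiff_child n f I J x : D n I -> ch D n I J -> J x ->
  sqdiff n f x = (ravg P J f - ravg P I f) ^+ 2.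
Proof.
move=> DI IJ Jx; have Ix : I x by case: IJ => _; apply.
rewrite /sqdiff (fsbigD1 I) //= [X in _ + X]fsbig1 => [|L [/= DL LI]].
  rewrite addr0 /Delta (sum_atoms n.+1 _ _ J) // => [|K []//].
  by rewrite indicE mem_set // mul1r.
have Lx : ~ L x by move=> Lx; apply: LI; exact: atom_uniq DL DI Lx Ix.
rewrite /Delta indicE memNset // mul0r subr0 fsbig1 ?expr0n // => K [_ KL].
by rewrite indicE memNset ?mul0r // => /KL.
Qed.

(** The passage from the tree to integrals: [sqdiff] is constant on each child, so an edge term is
    the integral of [sqdiff] times [w] over that child. *)
Lemma path_sum_sqdiff (w f : T -> R) k n I : D n I ->
  measurable_fun setT w -> P.-integrable setT (EFin \o w) -> (forall x, 0 < w x) ->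
  (path_sum kids (fun x y => (avg vol (mass f) y - avg vol (mass f) x) ^+ 2 * mass w y)
     k (n, I))%:E = (\sum_(j < k) \int[P]_(x in I) (sqdiff (n + j) f x * w x)%:E)%E.
Proof.
move=> + mw wi w0; elim: k n I => [|k IH] n I DI; first by rewrite big_ord0.
have qw0 m x : (0 <= (sqdiff m f x * w x)%:E)%E.
  by rewrite lee_fin mulr_ge0 ?sqdiff_ge0 // ltW.
have mqw m : measurable_fun setT (fun x => (sqdiff m f x * w x)%:E).
  by apply/measurable_EFinP; apply: measurable_funM => //; exact: measurable_sqdiff.
under eq_bigr do rewrite (ge0_integral_children _ _ _ DI) //.
rewrite exchange_big /= big_map -sumEFin; apply: eq_big_seq => J JI.
have [DJ sJI] := children_ch _ _ _ JI.
rewrite EFinD IH // big_ord_recl /= addn0; congr (_ + _)%E; last first.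
  by apply: eq_bigr => i _; rewrite /bump /= addnA addn1.
have mJ := measurable_atom _ _ DJ.
under eq_integral => x.
  rewrite inE => Jx; rewrite (sqdiff_child n f I J) // EFinM; over.
rewrite ge0_integralZl //; last 3 first.
- by apply/measurable_EFinP; exact: measurable_funTS.
- by move=> x _; rewrite lee_fin ltW.
- by rewrite lee_fin sqr_ge0.
rewrite EFinM -!ravg_avg /mass fineK //; apply: integrable_fin_num => //.
by apply: integrableS wi.
Qed.

(** At the end of each path the running maximum is a constant lying below [g] on the last node. The
    local maximal function will take the place of [g]. *)
Lemma pathmax_le_integral (u : T -> R) (g : T -> \bar R) n k m I : D n I ->
  measurable_fun setT g -> (forall x, 0 <= g x)%E ->
  (forall j J x, D j J -> (n <= j)%N -> I x -> J x -> ((avg vol (mass u) (j, J))%:E <= g x)%E) ->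
  (forall x, I x -> (m%:E <= g x)%E) ->
  ((pathmax kids vol (mass u) k m (n, I))%:E <= \int[P]_(x in I) g x)%E.
Proof.
move=> + mg g0; elim: k m n I => [|k IH] m n I DI ug mg_.
  have mI := measurable_atom _ _ DI.
  rewrite /= EFinM /vol /= fineK ?fin_num_measure //.
  set c := Num.max _ _.
  have cg x : I x -> (c%:E <= g x)%E.
    by move=> Ix; rewrite EFin_max ge_max mg_ //= (ug n).
  have [c0|c0] := leP c 0.
    apply: (@le_trans _ _ 0%E); last by apply: integral_ge0.
    by rewrite mule_le0_ge0.
  rewrite -integral_cst //; apply: ge0_le_integral => //.
  - by move=> x _; rewrite lee_fin ltW.
  - exact: measurable_funTS.
rewrite (ge0_integral_children _ _ _ DI) //= big_map -sumEFin.
rewrite big_seq [leRHS]big_seq; apply: lee_sum => J JI.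
have [DJ sJI] := children_ch _ _ _ JI.
apply: IH => //.
  by move=> j K x DK nj Jx Kx; apply: (ug j) => //; [exact: ltnW|exact: sJI].
move=> x /sJI Ix; rewrite EFin_max ge_max mg_ //= (ug n) //.
Qed.

(** * The local maximal function *)

Section LocalMaximal.
Variable u : T -> R.
Hypothesis iu : P.-integrable setT (EFin \o u).
Hypothesis u0 : forall x, 0 < u x.

(** The conditional expectation of [u] on generation [k]; it exhibits the maximal function as a
    countable supremum of measurable functions. *)
Let h k x : R := \sum_(J \in D k) (\1_J x) * avg vol (mass u) (k, J).

Let avg_u_ge0 x : 0 <= avg vol (mass u) x.
Proof.
apply: divr_ge0; last exact: fine_ge0.
by apply: Rintegral_ge0 => y _; exact: ltW.
Qed.

Let h_ge0 k x : 0 <= h k x.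
Proof.
by rewrite /h fsbig_finite // sumr_ge0 // => J _; rewrite mulr_ge0.
Qed.

Let mh k : measurable_fun setT (fun x => (h k x)%:E).
Proof.
apply/measurable_EFinP; apply: (measurable_fsum_atoms k) => // J /measurable_atom mJ.
by apply: measurable_funM => //; exact: measurable_indic.
Qed.

Let hE k J x : D k J -> J x -> h k x = avg vol (mass u) (k, J).
Proof. by move=> DJ Jx; rewrite /h (sum_atoms k _ (fun J => avg vol (mass u) (k, J)) J). Qed.

Let g n x := esups (fun k => (h k x)%:E) n.

Let g_ge n k x : (n <= k)%N -> ((h k x)%:E <= g n x)%E.
Proof. by move=> nk; apply: ereal_sup_ubound; exists k. Qed.

(** By nesting, the atoms in the supremum are exactly those of generation at least [n] through
    [x]. *)
Let MlocE n I x : D n I -> I x -> Mloc P D n I u x = g n x.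
Proof.
move=> DI Ix; rewrite /Mloc asboolT // /g /esups; congr ereal_sup.
have abs_eavg k J : D k J -> `|eavg P J (fun y => (u y)%:E)|%E = (avg vol (mass u) (k, J))%:E.
  by move=> DJ; rewrite (eavg_avg u (k, J)) //= ger0_norm.
apply/seteqP; split => y.
  move=> [J [k [nk DJ JI Jx]] <-]; exists k => //.
  by rewrite (hE k J) // (abs_eavg k).
move=> [k /= nk <-]; have [J DJ Jx] := atoms_cover k x.
exists J; last by rewrite (hE k J) // (abs_eavg k).
exists k; split => //; exact: atom_nested_le nk DI DJ Ix Jx.
Qed.

Lemma pathmax_le_Mloc n k I : D n I ->
  ((pathmax kids vol (mass u) k 0 (n, I))%:E <= \int[P]_(x in I) Mloc P D n I u x)%E.
Proof.
move=> DI; rewrite (eq_integral (g n)); last by move=> x; rewrite inE => /MlocE ->.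
have g0 x : (0 <= g n x)%E.
  by apply: le_trans (g_ge n n x (leqnn n)); rewrite lee_fin.
apply: pathmax_le_integral => //.
  exact: measurable_fun_esups.
by move=> j J x DJ nj Ix Jx; rewrite -(hE j J x DJ Jx) g_ge.
Qed.

Let integral_Mloc_ge0 n I : D n I -> (0 <= \int[P]_(x in I) Mloc P D n I u x)%E.
Proof.
move=> DI; apply: integral_ge0 => x Ix; rewrite MlocE //.
by apply: le_trans (g_ge n n x (leqnn n)); rewrite lee_fin.
Qed.

Let integral_Mloc_le n I : D n I -> 0 < mass u (n, I) ->
  ((\int[P]_(x in I) Mloc P D n I u x) * ((mass u (n, I))^-1)%:E <= Ainf P D u)%E.
Proof.
move=> DI s0; have p0 := vol_gt0 (n, I) DI.
set M := (\int[P]_(x in I) _)%E.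
apply: ereal_sup_ubound; exists (n, I) => //=.
rewrite (eavg_avg u (n, I)) // /eavg -/M inver gt_eqF; last by rewrite divr_gt0.
rewrite -muleA -EFinM; congr (_ * _%:E)%E.
by rewrite /avg /vol /=; field; rewrite !gt_eqF.
Qed.

Lemma Ainf_ge0 n I : D n I -> 0 < mass u (n, I) -> (0 <= Ainf P D u)%E.
Proof.
move=> DI s0; apply: le_trans (integral_Mloc_le n I DI s0).
by rewrite mule_ge0 ?integral_Mloc_ge0 // lee_fin invr_ge0 ltW.
Qed.

Lemma pathmax_le_Ainf n k I : D n I -> (Ainf P D u < +oo)%E -> 0 < mass u (n, I) ->
  pathmax kids vol (mass u) k 0 (n, I) <= fine (Ainf P D u) * mass u (n, I).
Proof.
move=> DI Afin s0; rewrite -lee_fin EFinM fineK; last first.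
  by rewrite ge0_fin_numE // (Ainf_ge0 n I).
apply: le_trans (pathmax_le_Mloc n k I DI) _.
by rewrite -lee_pdivrMr // integral_Mloc_le.
Qed.

End LocalMaximal.

(** * Weights that are positive everywhere *)

Section PositiveWeight.
Variables w f : T -> R.
Hypothesis mw : measurable_fun setT w.
Hypothesis iw : P.-integrable setT (EFin \o w).
Hypothesis w0 : forall x, 0 < w x.
Hypothesis A2_fin : (A2 P D w < +oo)%E.
Hypothesis mf : measurable_fun setT f.
Hypothesis f2w_fin : (\int[P]_x (f x ^+ 2 * w x)%:E < +oo)%E.

Let u x := (w x)^-1.

Let u0 x : 0 < u x. Proof. by rewrite invr_gt0. Qed.

Let root : node (0%N, setT). Proof. by rewrite /node atoms0. Qed.

Let mu : measurable_fun setT u.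
Proof. exact: measurable_fun_invr. Qed.

Let integral_w_gt0 : (0 < \int[P]_x (w x)%:E)%E.
Proof.
have w0' x : (0 <= (w x)%:E)%E by rewrite lee_fin ltW.
rewrite lt_neqAle integral_ge0 // andbT; apply/eqP => E0.
have [+ _] := ae_eq_integral_abs P measurableT (measurable_int P iw).
case.
  by rewrite [RHS]E0; apply: eq_integral => x _; rewrite gee0_abs /=.
move=> N [mN N0 sub]; have : (P setT <= P N)%E.
  apply: le_measure; rewrite ?inE // => x _; apply: sub => /= /(_ Logic.I)[wx].
  by have := w0 x; rewrite wx ltxx.
by rewrite N0 probability_setT lee_fin ler10.
Qed.

(** At the root, an infinite mean of [u] times the positive mean of [w] would make [A2] infinite. *)
Let iu : P.-integrable setT (EFin \o u).
Proof.
have u0' x : (0 <= (u x)%:E)%E by rewrite lee_fin ltW.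
apply/integrableP; split; first exact/measurable_EFinP.
rewrite (eq_integral (EFin \o u)); last by move=> x _; rewrite gee0_abs /=.
rewrite ltey; apply/eqP => E.
have : (eavg P setT (EFin \o w) * eavg P setT (EFin \o u) <= A2 P D w)%E.
  by apply: ereal_sup_ubound; exists setT => //; exists 0%N.
rewrite /eavg probability_setT invr1 !mule1 E gt0_muley // leye_eq.
by move=> /eqP A2y; move: A2_fin; rewrite A2y.
Qed.

Let if2w : P.-integrable setT (EFin \o (fun x => f x ^+ 2 * w x)).
Proof.
apply/integrableP; split.
  by apply/measurable_EFinP; apply: measurable_funM => //; exact: measurable_funX.
rewrite (eq_integral (fun x => (f x ^+ 2 * w x)%:E)) // => x _.
by rewrite gee0_abs //= lee_fin mulr_ge0 ?sqr_ge0 // ltW.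
Qed.

(** Domination by AM-GM: the absolute value of [f] is at most [f ^+ 2 * w + u]. *)
Let intf : P.-integrable setT (EFin \o f).
Proof.
apply: (le_integrable measurableT _ _ (integrableD measurableT if2w iu)).
  exact/measurable_EFinP.
move=> x _ /=; rewrite lee_fin [leRHS]ger0_norm; last first.
  by rewrite addr_ge0 ?(ltW (u0 x)) // mulr_ge0 ?sqr_ge0 // ltW.
rewrite -[f x ^+ 2]real_normK ?num_real // -subr_ge0.
set y := `|f x|; have wx := w0 x.
have -> : y ^+ 2 * w x + u x - y = ((y * w x - 1 / 2) ^+ 2 + 3 / 4) / w x.
  by rewrite /u; field; rewrite gt_eqF.
by rewrite divr_ge0 ?(ltW wx) // addr_ge0 ?sqr_ge0.
Qed.

Let Q := fine (A2 P D w).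

Let A2_ge x : node x ->
  ((avg vol (mass w) x * avg vol (mass u) x)%:E <= A2 P D w)%E.
Proof.
move=> nx; rewrite EFinM -!eavg_avg //; apply: ereal_sup_ubound.
by exists x.2 => //; exists x.1.
Qed.

Let mass_ge0 g x : (forall y, 0 <= g y) -> 0 <= mass g x.
Proof. by move=> g0; apply: Rintegral_ge0. Qed.

Lemma A2_finE : A2 P D w = Q%:E.
Proof.
rewrite fineK // ge0_fin_numE //; apply: le_trans (A2_ge _ root).
rewrite lee_fin mulr_ge0 // divr_ge0 ?mass_ge0 ?fine_ge0 // => y; exact: ltW.
Qed.

Let vs_le x : node x -> mass w x * mass u x <= Q * vol x ^+ 2.
Proof.
move=> nx; have p0 := vol_gt0 x nx.
have := A2_ge x nx; rewrite A2_finE lee_fin /avg mulrACA -invfM -expr2.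
by rewrite ler_pdivrMr // exprn_gt0.
Qed.

(** Cauchy-Schwarz for the constant function 1. *)
Let p_le x : node x -> vol x ^+ 2 <= mass w x * mass u x.
Proof.
move=> nx; rewrite vol_mass //.
have wE : (fun y => cst 1 y ^+ 2 * w y) = w by apply/funext => y; rewrite expr1n mul1r.
rewrite -[in leRHS]wE; apply: mass_Cauchy_Schwarz => //.
  exact: integrable_cst1.
by rewrite wE.
Qed.

Let mass_gt0 x : node x -> 0 < mass w x /\ 0 < mass u x.
Proof.
move=> nx; have p0 := vol_gt0 x nx.
have : 0 < mass w x * mass u x by apply: lt_le_trans (p_le x nx); rewrite exprn_gt0.
have u0' : 0 <= mass u x by apply: mass_ge0 => y; exact: ltW.
have w0' : 0 <= mass w x by apply: mass_ge0 => y; exact: ltW.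
by rewrite !lt_neqAle u0' w0' !andbT ![0 == _]eq_sym mulf_eq0 negb_or => /andP[/andP[-> ->]].
Qed.

Lemma pathmax_le_A2 k x : node x ->
  pathmax kids vol (mass u) k 0 x <= 2 * Q * mass u x.
Proof.
move=> nx; apply: (pathmax_le kids node vol (mass u) (mass w) Q) => //.
- exact: node_kids.
- exact: vol_gt0.
- by move=> y /mass_gt0[].
- by move=> y /mass_gt0[].
- exact: volD.
- by move=> y ny; apply: massD.
- by move=> y ny; apply: massD.
Qed.

Lemma integral_Ssq_le K :
  (forall k x, node x -> pathmax kids vol (mass u) k 0 x <= K * mass u x) ->
  (\int[P]_x (Ssq P D f x * (w x)%:E)
   <= (354 * Q * K)%:E * \int[P]_x (f x ^+ 2 * w x)%:E)%E.
Proof.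
move=> HK.
have qw0 n x : (0 <= (sqdiff n f x * w x)%:E)%E.
  by rewrite lee_fin mulr_ge0 ?sqdiff_ge0 // ltW.
rewrite (eq_integral (fun x => \sum_(0 <= n <oo) (sqdiff n f x * w x)%:E)%E); last first.
  move=> x _; rewrite /Ssq muleC -nneseriesZl => [|n _]; last by rewrite lee_fin sqdiff_ge0.
  by apply: eq_eseriesr => n _; rewrite -EFinM mulrC.
rewrite integral_nneseries //; last first.
  move=> n; apply/measurable_EFinP; apply: measurable_funM => //.
  exact: measurable_sqdiff.
apply: lime_le.
  by apply: is_cvg_nneseries => n _ _; apply: integral_ge0.
apply: nearW => N; rewrite big_mkord.
rewrite -[X in (_ * X)%E]fineK; last by apply: integrable_fin_num.
(* A partial sum is a path sum from the root, which the tree estimate bounds uniformly in [N]. *)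
rewrite -EFinM -(path_sum_sqdiff w f N 0 setT) // lee_fin.
pose G := mass (fun x => f x ^+ 2 * w x).
apply: (square_function_tree kids node vol (mass u) (mass w) Q _ _ _ _ _ _ _ _ _
  (mass f) G _ _ _ K _ N (0%N, setT)) => //.
- exact: node_kids.
- exact: vol_gt0.
- by move=> y /mass_gt0[].
- by move=> y /mass_gt0[].
- exact: volD.
- by move=> y ny; apply: massD.
- by move=> y ny; apply: massD.
- by move=> y ny; apply: massD.
- by move=> y ny; apply: massD.
- by move=> y ny; apply: mass_Cauchy_Schwarz.
Qed.

(** Taking [K = 2 * Q] gives the factor [708] under the root, and [K = [u]_infty] gives [354]; both
    are below [27 ^+ 2 = 729]. *)
Lemma S_L2w_le :
  (S_L2w P D w f <=
       27%:E * A2 P D w `^ (2^-1)%R * Ainf P D u `^ (2^-1)%R * L2w P w f)%E /\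
  (S_L2w P D w f <= 27%:E * A2 P D w * L2w P w f)%E.
Proof.
have B_ge0 (a b e : R) : 0 <= a -> 0 <= b -> 0 <= e -> 0 <= 354 * a * b * e.
  by move=> a0 b0 e0; exact: mulr_ge0 (mulr_ge0 (mulr_ge0 (ler0n _ _) a0) b0) e0.
have Q1 : 1 <= Q.
  have := le_trans (p_le _ root) (vs_le _ root).
  by rewrite -[leLHS]mul1r ler_pM2r // exprn_gt0 // vol_gt0.
set I2 := (\int[P]_x (f x ^+ 2 * w x)%:E)%E.
have [g gE] : exists g, I2 = g%:E.
  by exists (fine I2); rewrite fineK //; apply: integrable_fin_num.
have g0 : 0 <= g.
  by rewrite -lee_fin -gE; apply: integral_ge0 => x _; rewrite lee_fin mulr_ge0 ?sqr_ge0 // ltW.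
have Ssq0 : (0 <= \int[P]_x (Ssq P D f x * (w x)%:E))%E.
  apply: integral_ge0 => x _; rewrite mule_ge0 ?lee_fin ?(ltW (w0 x)) //.
  by apply: nneseries_ge0 => n _ _; rewrite lee_fin; exact: sqdiff_ge0.
have SK K : 0 <= K -> (forall k x, node x -> pathmax kids vol (mass u) k 0 x <= K * mass u x) ->
    (S_L2w P D w f <= (Num.sqrt (354 * Q * K * g))%:E)%E.
  move=> K0 /integral_Ssq_le; rewrite -/I2 gE -EFinM => h.
  have B0 : 0 <= 354 * Q * K * g by apply: B_ge0 => //; exact: le_trans ler01 Q1.
  rewrite -powR12_sqrt // -poweR_EFin /S_L2w.
  by apply: gt0_ler_poweR; rewrite ?in_itv /= ?Ssq0 ?leey ?lee_fin ?B0.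
have L2E : L2w P w f = (Num.sqrt g)%:E.
  by rewrite /L2w -/I2 gE poweR_EFin powR12_sqrt.
have claim2 : (S_L2w P D w f <= 27%:E * A2 P D w * L2w P w f)%E.
  apply: le_trans (SK (2 * Q) _ (fun k x => pathmax_le_A2 k x)) _; first lra.
  rewrite A2_finE L2E -!EFinM lee_fin.
  have -> : 27 * Q * Num.sqrt g = Num.sqrt ((27 * Q) ^+ 2 * g).
    by rewrite sqrtrM ?sqr_ge0 // sqrtr_sqr ger0_norm //; lra.
  rewrite ler_wsqrtr //.
  have -> : 354 * Q * (2 * Q) * g = 708 * (Q ^+ 2 * g) by ring.
  have := mulr_ge0 (sqr_ge0 Q) g0; lra.
split => //.
have [Ainfy|Afin] := eqVneq (Ainf P D u) +oo%E.
  (* If [f] has norm 0, the product with [+oo] is 0 by convention, and the second estimate serves;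
     otherwise the right side is [+oo]. *)
  have [g00|gn0] := eqVneq g 0.
    apply: le_trans claim2 _.
    by rewrite L2E g00 sqrtr0 !mule0.
  rewrite Ainfy poweRyr // L2E A2_finE poweR_EFin -EFinM gt0_muley; last first.
    by rewrite lte_fin mulr_gt0 // powR_gt0; lra.
  by rewrite gt0_mulye ?leey // lte_fin sqrtr_gt0 lt_neqAle eq_sym gn0.
have Alty : (Ainf P D u < +oo)%E by rewrite ltey.
have Age0 := Ainf_ge0 u iu u0 _ _ root (mass_gt0 _ root).2.
have A0 : 0 <= fine (Ainf P D u) by exact: fine_ge0.
have Af : Ainf P D u = (fine (Ainf P D u))%:E by rewrite fineK // ge0_fin_numE.
apply: le_trans (SK (fine (Ainf P D u)) A0 _) _.
  by move=> k [n I] nx; apply: pathmax_le_Ainf => //; have [] := mass_gt0 _ nx.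
rewrite Af A2_finE L2E !poweR_EFin -!EFinM lee_fin !powR12_sqrt //; last lra.
move: (fine _) A0 => K K0.
have -> : 27 * Num.sqrt Q * Num.sqrt K * Num.sqrt g = Num.sqrt (27 ^+ 2 * Q * K * g).
  have Q0 : 0 <= Q by lra.
  by do 3![rewrite sqrtrM ?mulr_ge0 //]; rewrite sqrtr_sqr ger0_norm.
rewrite ler_wsqrtr //=.
have : 0 <= Q * K * g by rewrite !mulr_ge0 //; lra.
lra.
Qed.

End PositiveWeight.

(** * Changing the weight on a null set *)

Section AlmostEverywhere.
Variables w1 w2 : T -> R.
Hypothesis mw1 : measurable_fun setT w1.
Hypothesis mw2 : measurable_fun setT w2.
Hypothesis w12 : {ae P, forall x, w1 x = w2 x}.

Lemma integral_ae_mul I (g : T -> \bar R) : measurable I -> measurable_fun setT g ->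
  (\int[P]_(x in I) (g x * (w1 x)%:E) = \int[P]_(x in I) (g x * (w2 x)%:E))%E.
Proof.
move=> mI mg; apply: ae_eq_integral => //.
- apply: measurable_funTS; apply: emeasurable_funM => //; exact/measurable_EFinP.
- apply: measurable_funTS; apply: emeasurable_funM => //; exact/measurable_EFinP.
- by apply: filterS w12 => x -> _.
Qed.

Lemma eavg_ae I : measurable I ->
  eavg P I (fun x => (w1 x)%:E) = eavg P I (fun x => (w2 x)%:E).
Proof.
move=> mI; congr (_ * _)%E.
have := integral_ae_mul I (cst 1%E) mI (measurable_cst _).
by under eq_integral do rewrite mul1e; under [in RHS]eq_integral do rewrite mul1e.
Qed.

End AlmostEverywhere.

Lemma A2_ae w1 w2 : measurable_fun setT w1 -> measurable_fun setT w2 ->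
  {ae P, forall x, w1 x = w2 x} -> A2 P D w1 = A2 P D w2.
Proof.
move=> m1 m2 w12; have i12 : {ae P, forall x, (w1 x)^-1 = (w2 x)^-1}.
  by apply: filterS w12 => x ->.
congr ereal_sup; apply: eq_imagel => I [n /measurable_atom mI].
by congr (_ * _)%E; apply: eavg_ae => //; exact: measurable_fun_invr.
Qed.

(** [Mloc] sees the weight only through averages over atoms, so the two maximal functions agree at
    every point. *)
Lemma Ainf_ae u1 u2 : measurable_fun setT u1 -> measurable_fun setT u2 ->
  {ae P, forall x, u1 x = u2 x} -> Ainf P D u1 = Ainf P D u2.
Proof.
move=> m1 m2 u12.
have ME n I : Mloc P D n I u1 = Mloc P D n I u2.
  apply/funext => x; rewrite /Mloc; case: ifP => // _.
  congr ereal_sup; apply: eq_imagel => J [k [_ /measurable_atom mJ _ _]].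
  by rewrite (eavg_ae u1 u2).
congr ereal_sup; apply: eq_imagel => -[n I] /= /measurable_atom mI.
by rewrite ME (eavg_ae u1 u2).
Qed.

Lemma measurable_Ssq f : measurable_fun setT (Ssq P D f).
Proof.
apply: ge0_emeasurable_sum => [n x _ _|n _]; first by rewrite lee_fin sqdiff_ge0.
by apply/measurable_EFinP; exact: measurable_sqdiff.
Qed.

End AtomicFiltration.

Theorem theorem3p6 :
  exists C : nat, forall (R : realType) (d : measure_display)
    (T : measurableType d) (P : probability T R) (D : nat -> set (set T))
    (w f : T -> R),
    atomic_filtration P D ->
    measurable_fun setT w ->
    P.-integrable setT (fun x => (w x)%:E) ->
    {ae P, forall x, 0 < w x} ->
    (A2 P D w < +oo)%E ->
    measurable_fun setT f ->
    (\int[P]_x (((f x) ^+ 2 * w x)%:E) < +oo)%E ->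
    (S_L2w P D w f <=
       (C%:R)%:E * (A2 P D w) `^ (2^-1)%R * (Ainf P D (fun x => ((w x)^-1)%R)) `^ (2^-1)%R
       * L2w P w f)%E /\
    (S_L2w P D w f <= (C%:R)%:E * A2 P D w * L2w P w f)%E.
Proof.
exists 27%N => R d T P D w f PD mw iw w0 A2w mf f2w.
(* A version of [w] that is positive everywhere; the change on a null set affects no quantity in the
   statement. *)
pose w' x := if 0 < w x then w x else 1.
have mw' : measurable_fun setT w'.
  by apply: measurable_fun_ifT => //; exact: measurable_fun_ltr.
have ww' : {ae P, forall x, w x = w' x}.
  by apply: filterS w0 => x wx; rewrite /w' wx.
have w'0 x : 0 < w' x by rewrite /w'; case: ifP.
have mI : measurable_fun setT (fun x => (w x)^-1) by exact: measurable_fun_invr.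
have mI' : measurable_fun setT (fun x => (w' x)^-1) by exact: measurable_fun_invr.
have AE : A2 P D w = A2 P D w' by exact: A2_ae.
have AiE : Ainf P D (fun x => (w x)^-1) = Ainf P D (fun x => (w' x)^-1).
  by apply: Ainf_ae => //; apply: filterS ww' => x ->.
have SE : S_L2w P D w f = S_L2w P D w' f.
  congr (_ `^ _)%E; apply: integral_ae_mul => //; exact: measurable_Ssq.
have f2E : (\int[P]_x (f x ^+ 2 * w x)%:E = \int[P]_x (f x ^+ 2 * w' x)%:E)%E.
  apply: (integral_ae_mul _ _ _ mw mw' ww' setT (fun x => (f x ^+ 2)%:E)) => //.
  by apply/measurable_EFinP; exact: measurable_funX.
have LE : L2w P w f = L2w P w' f by congr (_ `^ _)%E.
have iw' : P.-integrable setT (EFin \o w').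
  apply/integrableP; split; first exact/measurable_EFinP.
  have [_] := integrableP _ _ _ iw; congr (_ < _)%E.
  apply: ae_eq_integral => //.
  - by apply: measurableT_comp => //; exact/measurable_EFinP.
  - by apply: measurableT_comp => //; exact/measurable_EFinP.
  - by apply: filterS ww' => x /= ->.
rewrite AE AiE SE LE; apply: S_L2w_le => //.
  by rewrite -AE.
by rewrite -f2E.
Qed.
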